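(* Let $\mathbf{F}_{T,v}$, $B(\mathbf{v})=\mathrm{tr}\{\mathbf{F}_{T,v}^{-1}\}$, $\bar{\Delta}_{T,v}$, $\alpha_{\max}^2$, $\sigma_{\min}^2$, $\boldsymbol{l}_q$ and $d_{t,q}$ be as defined in the context. The Cramér–Rao lower bound of $\mathbf{v}$ satisfies $B(\mathbf{v})=\mathrm{tr}\{\mathbf{F}_{T,v}^{-1}\}\ge\bar{\Delta}_{T,v}$, with equality achieved when $\sigma_{\min}^2=\sigma_q^2$ and $\alpha_{\max}^2=\alpha_q^2$ for all $q$. In addition, $$\bar{\Delta}_{T,v}\to C_v=\Big(\frac{\alpha_{\max}^2}{\sigma_{\min}^2}\sum_{q=1}^{Q}s_{\infty,q}^{(2)}\|\mathbf{P}_v^{\bot}\boldsymbol{l}_q\|^2\Big)^{-1}\qquad\text{as }T\to\infty,$$ where $$s_{\infty,q}^{(2)}=\lim_{T\to\infty}\sum_{t=1}^{T}\frac{t^2}{d_{t,q}^4},\qquad \mathbf{P}_v^{\bot}=\mathbf{I}-\frac{\mathbf{v}\mathbf{v}^{\mathrm T}}{\|\mathbf{v}\|^2},$$ and $s_{\infty,q}^{(2)}$ is upper bounded by $\frac{1}{\rho^4}\lim_{T\to\infty}\sum_{t=1}^{T}\frac{1}{t^2}\approx\frac{\pi^2}{6\rho^4}$, where $\rho>0$ is sufficiently small such that $d_{t,q}>\rho t$ for all $t\ge1$.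
   Context: A mobile user moves along $\mathbf{x}_t=\mathbf{x}+t\mathbf{v}$, $t=1,2,\dots$, with $\mathbf{x},\mathbf{v}\in\mathbb{R}^2$, $\mathbf{v}\neq0$. There are finitely many base stations $q=1,\dots,Q$ at locations $\mathbf{o}_q\in\mathbb{R}^2$ (a limited region), and base station $q$ observes, at every $t$, $y_{t,q}=\beta_q+\alpha_q\log d_{t,q}+\xi_{q,t}$ with independent Gaussian noise $\xi_{q,t}\sim\mathcal{N}(0,\sigma_q^2)$, where $\boldsymbol{l}_q=\mathbf{x}-\mathbf{o}_q$ and $d_{t,q}=\|\boldsymbol{l}_q+t\mathbf{v}\|_2$. The trajectory does not pass through any base station: $\min_t d_{t,q}>0$ for all $q$; and $\boldsymbol{l}_q$ and $\mathbf{v}$ are linearly independent for at least one $q$. Put $\alpha_{\max}^2=\max_q\alpha_q^2$ and $\sigma_{\min}^2=\min_q\sigma_q^2$. The Fisher information matrix of the velocity $\mathbf{v}$ from the measurements at $t=1,\dots,T$ is $$\mathbf{F}_{T,v}=\sum_{t=1}^{T}\sum_{q=1}^{Q}\frac{\alpha_q^2t^2}{\sigma_q^2d_{t,q}^4}(\boldsymbol{l}_q+t\mathbf{v})(\boldsymbol{l}_q+t\mathbf{v})^{\mathrm T},$$ and $B(\mathbf{v})=\mathrm{tr}\{\mathbf{F}_{T,v}^{-1}\}$ is called the Cramér–Rao lower bound for $\mathbf{v}$. The quantity $\bar{\Delta}_{T,v}$ is $$\bar{\Delta}_{T,v}=\frac{\sigma_{\min}^2}{\alpha_{\max}^2}\,\lambda_{\min}(\mathbf{A}_{T,v})^{-1},\qquad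 \mathbf{A}_{T,v}=\sum_{t=1}^{T}\sum_{q=1}^{Q}\frac{t^2}{d_{t,q}^4}(\boldsymbol{l}_q+t\mathbf{v})(\boldsymbol{l}_q+t\mathbf{v})^{\mathrm T},$$ with $\lambda_{\min}$ the smallest eigenvalue.
   Formalization: The equality clause is false for every T with F invertible (the trace also contains 1/λ_max(F) > 0); for equal σ_q² and α_q² it is replaced by Δ_T = 1/λ_min(F_T) for all T and B(v) − Δ_T → 0 as T → ∞. *)

(* Defs.v *)
From HB Require Import structures.
From mathcomp Require Import all_boot all_order all_algebra.
From mathcomp Require Import all_classical all_reals all_analysis.

Set Implicit Arguments.
Unset Strict Implicit.
Unset Printing Implicit Defensive.

Import Order.TTheory GRing.Theory Num.Theory.
Import numFieldNormedType.Exports.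
Local Open Scope classical_set_scope.
Local Open Scope ring_scope.

(* The norm `|u| carried by 'cV[R]_n in MathComp-Analysis is the sup norm,
   hence a separate Euclidean norm. *)
Definition enorm (R : realType) (n : nat) (u : 'cV[R]_n) : R :=
  Num.sqrt (\sum_(i < n) u i 0 ^+ 2).

(* Smallest eigenvalue. The matrices below are real symmetric of size 2, so the
   set of eigenvalues is finite and nonempty and the infimum is a minimum. *)
Definition lambda_min (R : realType) (n : nat) (M : 'M[R]_n) : R :=
  inf [set a : R | eigenvalue M a].

(* Extrema over a finite set of stations, nonempty as soon as 0 < Q. *)
Definition alpha_max2 (R : realType) (Q : nat) (alpha : 'I_Q -> R) : R :=
  sup [set alpha q ^+ 2 | q in [set: 'I_Q]].

Definition sigma_min2 (R : realType) (Q : nat) (sigma : 'I_Q -> R) : R :=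
  inf [set sigma q ^+ 2 | q in [set: 'I_Q]].

Definition offset (R : realType) (Q : nat) (x : 'cV[R]_2)
    (o : 'I_Q -> 'cV[R]_2) (q : 'I_Q) : 'cV[R]_2 := x - o q.

Definition relpos (R : realType) (Q : nat) (x v : 'cV[R]_2)
    (o : 'I_Q -> 'cV[R]_2) (t : nat) (q : 'I_Q) : 'cV[R]_2 :=
  offset x o q + t%:R *: v.

Definition dist (R : realType) (Q : nat) (x v : 'cV[R]_2)
    (o : 'I_Q -> 'cV[R]_2) (t : nat) (q : 'I_Q) : R := enorm (relpos x v o t q).

Definition fisher_v (R : realType) (Q : nat) (x v : 'cV[R]_2)
    (o : 'I_Q -> 'cV[R]_2) (alpha sigma : 'I_Q -> R) (T : nat) : 'M[R]_2 :=
  \sum_(1 <= t < T.+1) \sum_(q < Q)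
    (alpha q ^+ 2 * t%:R ^+ 2 / (sigma q ^+ 2 * dist x v o t q ^+ 4)) *:
      (relpos x v o t q *m (relpos x v o t q)^T).

(* Meaningful only when the Fisher information matrix is invertible:
   invmx is the identity on singular matrices. *)
Definition crlb_v (R : realType) (Q : nat) (x v : 'cV[R]_2)
    (o : 'I_Q -> 'cV[R]_2) (alpha sigma : 'I_Q -> R) (T : nat) : R :=
  \tr (invmx (fisher_v x v o alpha sigma T)).

Definition A_v (R : realType) (Q : nat) (x v : 'cV[R]_2)
    (o : 'I_Q -> 'cV[R]_2) (T : nat) : 'M[R]_2 :=
  \sum_(1 <= t < T.+1) \sum_(q < Q)
    (t%:R ^+ 2 / dist x v o t q ^+ 4) *:
      (relpos x v o t q *m (relpos x v o t q)^T).

Definition Delta_v (R : realType) (Q : nat) (x v : 'cV[R]_2)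
    (o : 'I_Q -> 'cV[R]_2) (alpha sigma : 'I_Q -> R) (T : nat) : R :=
  sigma_min2 sigma / alpha_max2 alpha * (lambda_min (A_v x v o T))^-1.

Definition s2 (R : realType) (Q : nat) (x v : 'cV[R]_2)
    (o : 'I_Q -> 'cV[R]_2) (q : 'I_Q) (T : nat) : R :=
  \sum_(1 <= t < T.+1) t%:R ^+ 2 / dist x v o t q ^+ 4.

Definition s2_inf (R : realType) (Q : nat) (x v : 'cV[R]_2)
    (o : 'I_Q -> 'cV[R]_2) (q : 'I_Q) : R := limn (s2 x v o q).

Definition proj_perp (R : realType) (v : 'cV[R]_2) : 'M[R]_2 :=
  1%:M - (enorm v ^+ 2)^-1 *: (v *m v^T).

Definition C_v (R : realType) (Q : nat) (x v : 'cV[R]_2)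
    (o : 'I_Q -> 'cV[R]_2) (alpha sigma : 'I_Q -> R) : R :=
  (alpha_max2 alpha / sigma_min2 sigma *
   \sum_(q < Q) s2_inf x v o q * enorm (proj_perp v *m offset x o q) ^+ 2)^-1.

Definition invsq_sum (R : realType) (T : nat) : R :=
  \sum_(1 <= t < T.+1) (t%:R ^+ 2)^-1.

(* Main.v *)
Require Import Defs.
From HB Require Import structures.
From mathcomp Require Import all_boot all_order all_algebra.
From mathcomp Require Import all_classical all_reals all_analysis.
From mathcomp Require Import ring lra zify.

Set Implicit Arguments.
Unset Strict Implicit.
Unset Printing Implicit Defensive.

Import Order.TTheory GRing.Theory Num.Theory.
Import numFieldNormedType.Exports.
Local Open Scope classical_set_scope.
Local Open Scope ring_scope.

(* For a symmetric 2 x 2 matrix M, [lambda_min M] is the largest m such that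
   M - m I is positive semidefinite.  The Fisher matrix F is dominated by k A
   with k = alpha_max^2 / sigma_min^2, so lambda_min F <= k lambda_min A, while
   tr F^-1 = 1 / lambda_min F + 1 / lambda_max F; this gives B(v) >= Delta_T.

   For the limit, write A_T in the orthogonal frame formed by v and its rotation
   by a right angle.  The entry along v grows linearly in T, the transverse
   entry converges to |v|^2 * sum_q s_q |P l_q|^2, and the mixed entry is at most
   a multiple of the harmonic sum H_T.  The characteristic equation then puts
   |v|^2 lambda_min A_T within O(H_T^2 / T) of the transverse entry.

   The value of sum 1/t^2 is obtained from the half-angle identity
     4 / sin^2 y = 1 / sin^2 (y/2) + 1 / sin^2 (pi/2 - y/2).
   Iterated n times from y = pi/4 it gives
     sum_(k < 2^n) 1 / sin^2 ((2k+1) pi / 2^(n+2)) = 2 * 4^n,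
   and 1 / sin^2 y differs from 1 / y^2 by at most 1 on ]0, pi/2[. *)

(** * The Basel problem *)

(** The mean value theorem writes [sin x] as [x * cos c] with c in ]0, x[, and cos decreases
    there. *)
Lemma sin_bounds (R : realType) (x : R) : 0 < x -> x < pi / 2 ->
  x * cos x <= sin x <= x.
Proof.
move=> x0 xpi.
have [c /[!in_itv]/= /andP[c0 cx]] : exists2 c, c \in `]0, x[ &
    sin x - sin 0 = cos c * (x - 0).
  apply: MVT => //; apply: continuous_subspaceT => y; exact: continuous_sin.
rewrite sin0 !subr0 => ->.
rewrite mulrC ler_pM2r// ger_pMl// cos_le1 andbT.
have := @pi_gt0 R; move=> pi0.
by rewrite ltW// ltr_cos// !in_itv/=; apply/andP; split; lra.
Qed.

(** Square the bounds of [sin_bounds], using 1 / sin^2 - 1 = cos^2 / sin^2. *)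
Lemma invsq_sin_bounds (R : realType) (x : R) : 0 < x -> x < pi / 2 ->
  (sin x ^+ 2)^-1 - 1 <= (x ^+ 2)^-1 <= (sin x ^+ 2)^-1.
Proof.
move=> x0 xpi; have /andP[lo hi] := sin_bounds x0 xpi.
have s0 : 0 < sin x by apply: sin_gt0_pihalf; rewrite x0.
have c0 : 0 < cos x by apply: cos_gt0_pihalf; rewrite xpi andbT; lra.
have s20 : 0 < sin x ^+ 2 by exact: exprn_gt0.
have x20 : 0 < x ^+ 2 by exact: exprn_gt0.
apply/andP; split; last by rewrite lef_pV2// lerXn2r// nnegrE ltW.
rewrite -[_ - 1](_ : cos x ^+ 2 / sin x ^+ 2 = _); last first.
  by rewrite cos2sin2 mulrBl mul1r divff// gt_eqF.
rewrite ler_pdivrMr// mulrC ler_pdivlMr// mulrC -exprMn.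
by rewrite lerXn2r// nnegrE ?mulr_ge0// ltW.
Qed.

Lemma invsq_sin_half (R : realType) (y : R) :
  sin (y / 2) != 0 -> cos (y / 2) != 0 ->
  4 * (sin y ^+ 2)^-1 = (sin (y / 2) ^+ 2)^-1 + (sin (pi / 2 - y / 2) ^+ 2)^-1.
Proof.
move=> s0 c0.
have -> : sin (pi / 2 - y / 2) = cos (y / 2).
  by rewrite sinB sin_pihalf cos_pihalf mul1r mul0r subr0.
have {1}-> : y = (y / 2) *+ 2 by rewrite -mulr_natr mulfVK.
rewrite sin_mulr2n -mulr_natl.
move: s0 c0 (cos2Dsin2 (y / 2)); move: (sin _) (cos _) => s c s0 c0 h.
rewrite -[RHS]mul1r -h.
by field; rewrite s0 c0.
Qed.

Definition odd_angle (R : realType) (n k : nat) : R :=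
  (k.*2.+1)%:R * pi / (2 ^ n.+2)%:R.

Lemma odd_angle_itv (R : realType) (n k : nat) : (k < 2 ^ n)%N ->
  0 < odd_angle R n k < pi / 2.
Proof.
move=> kn; rewrite /odd_angle.
have e0 : 0 < (2 ^ n.+2)%:R :> R by rewrite ltr0n expn_gt0.
rewrite divr_gt0//= ?mulr_gt0 ?pi_gt0//= ltr_pdivrMr//.
rewrite [X in X < _]mulrC -mulrA ltr_pM2l ?pi_gt0// mulrC ltr_pdivlMr// -natrM
  ltr_nat.
by rewrite !expnS; lia.
Qed.

(** The half-angle identity splits each term of level n into two terms of level n + 1, at the
    indices k and 2^(n+1) - 1 - k. *)
Lemma sum_invsq_sin_odd_angle (R : realType) (n : nat) :
  \sum_(0 <= k < 2 ^ n) (sin (odd_angle R n k) ^+ 2)^-1 = 2 * 4 ^+ n.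
Proof.
elim: n => [|n IHn].
  rewrite big_nat1 expr0 mulr1 /odd_angle mul1r expnS expn1.
  have h := cos2Dsin2 (pi / 4 : R).
  have e : sin (pi / 4) = cos (pi / 4) :> R.
    rewrite -[in LHS](_ : pi / 2 - pi / 4 = pi / 4); last by field.
    by rewrite sinB sin_pihalf cos_pihalf mul1r mul0r subr0.
  have -> : (2 * 2)%:R = 4 :> R by [].
  have -> : sin (pi / 4) ^+ 2 = 2^-1 :> R by move: h; rewrite -e; lra.
  by rewrite invrK.
rewrite exprS mulrCA -IHn big_distrr/=.
rewrite (@big_cat_nat _ _ _ (2 ^ n)) ?leq_exp2l//=.
(* The upper half is reversed, so that both halves pair up at the same k. *)
rewrite [X in _ + X]big_nat_rev/= -[in X in _ + X](add0n (2 ^ n)%N) big_addn.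
have -> : (2 ^ n.+1 - 2 ^ n = 2 ^ n)%N by rewrite expnS mul2n -addnn addnK.
rewrite add0n.
rewrite -big_split/= !big_nat; apply: eq_bigr => k /andP[_ kn].
have /andP[a0 api] := odd_angle_itv R kn.
have e0 : (2 ^ n.+2)%:R != 0 :> R by rewrite pnatr_eq0 expn_eq0.
have h1 : odd_angle R n.+1 k = odd_angle R n k / 2.
  by rewrite /odd_angle (expnS 2 n.+2) natrM; field.
have h2 : odd_angle R n.+1 (2 ^ n + 2 ^ n.+1 - (k + 2 ^ n).+1)
    = pi / 2 - odd_angle R n k / 2.
  rewrite -h1 /odd_angle.
  have -> : (2 ^ n + 2 ^ n.+1 - (k + 2 ^ n).+1).*2.+1%:R =
      (2 ^ n.+2)%:R - (k.*2.+1)%:R :> R.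
    rewrite -natrB; last by rewrite !expnS; lia.
    by congr (_%:R); rewrite !expnS; lia.
  by rewrite (expnS 2 n.+2) natrM; field.
rewrite h1 h2 invsq_sin_half//.
  by rewrite gt_eqF// sin_gt0_pihalf//; apply/andP; split; lra.
by rewrite gt_eqF// cos_gt0_pihalf//; apply/andP; split; lra.
Qed.

Definition odd_invsq_sum (R : realType) (m : nat) : R :=
  \sum_(0 <= k < m) ((k.*2.+1)%:R ^+ 2)^-1.

(** Each of the 2^n terms 1 / y^2 falls short of 1 / sin^2 y by at most 1, so their sum over the odd
    angles lies between 2 * 4^n - 2^n and 2 * 4^n; the rest is rescaling. *)
Lemma odd_invsq_sum_bounds (R : realType) (n : nat) :
  pi ^+ 2 / 8 - pi ^+ 2 / 16 * (2 ^+ n)^-1 <= odd_invsq_sum R (2 ^ n)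
    <= pi ^+ 2 / 8.
Proof.
have p0 := @pi_gt0 R; have p20 : 0 < pi ^+ 2 :> R by exact: exprn_gt0.
have e0 : 0 < 2 ^+ n :> R by exact: exprn_gt0.
have sumE : \sum_(0 <= k < 2 ^ n) (odd_angle R n k ^+ 2)^-1 =
    16 * (2 ^+ n) ^+ 2 / pi ^+ 2 * odd_invsq_sum R (2 ^ n).
  rewrite /odd_invsq_sum big_distrr/=; apply: eq_bigr => k _.
  rewrite /odd_angle !natrX !exprS.
  have o0 : k.*2.+1%:R != 0 :> R by rewrite pnatr_eq0.
  move: (pi : R) p0 (_%:R) o0 => p p0 w w0; field.
  by rewrite w0 !gt_eqF.
have lo : 2 * (2 ^+ n) ^+ 2 - 2 ^+ n <=
    16 * (2 ^+ n) ^+ 2 / pi ^+ 2 * odd_invsq_sum R (2 ^ n).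
  rewrite -sumE -exprM mulnC exprM -natrX -sum_invsq_sin_odd_angle.
  have -> : (2 : R) ^+ n = \sum_(0 <= k < 2 ^ n) 1.
    by rewrite sumr_const_nat subn0 natrX.
  rewrite -sumrB !big_nat; apply: ler_sum => k /andP[_ kn].
  by have /andP[a0 api] := odd_angle_itv R kn;
    have /andP[] := invsq_sin_bounds a0 api.
have hi : 16 * (2 ^+ n) ^+ 2 / pi ^+ 2 * odd_invsq_sum R (2 ^ n) <=
    2 * (2 ^+ n) ^+ 2.
  rewrite -sumE -exprM mulnC exprM -natrX -sum_invsq_sin_odd_angle.
  rewrite !big_nat; apply: ler_sum => k /andP[_ kn].
  by have /andP[a0 api] := odd_angle_itv R kn;
    have /andP[] := invsq_sin_bounds a0 api.
have k0 : 0 < pi ^+ 2 / (16 * (2 ^+ n) ^+ 2) :> R.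
  by rewrite divr_gt0// mulr_gt0// exprn_gt0.
have E : odd_invsq_sum R (2 ^ n) = pi ^+ 2 / (16 * (2 ^+ n) ^+ 2) *
   (16 * (2 ^+ n) ^+ 2 / pi ^+ 2 * odd_invsq_sum R (2 ^ n)).
  by move: (pi : R) p0 => p p0; field; rewrite !gt_eqF.
rewrite E; apply/andP; split.
  apply: le_trans (_ : pi ^+ 2 / (16 * (2 ^+ n) ^+ 2) *
    (2 * (2 ^+ n) ^+ 2 - 2 ^+ n) <= _); last by rewrite ler_pM2l.
  by rewrite le_eqVlt; apply/orP; left; apply/eqP;
    move: (pi : R) => p; field; rewrite gt_eqF.
apply: (le_trans (_ : _ <= pi ^+ 2 / (16 * (2 ^+ n) ^+ 2) *
    (2 * (2 ^+ n) ^+ 2))); first by rewrite ler_pM2l.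
by rewrite le_eqVlt; apply/orP; left; apply/eqP;
    move: (pi : R) => p; field; rewrite gt_eqF.
Qed.

Lemma cvg_odd_invsq_sum (R : realType) :
  odd_invsq_sum R (2 ^ n) @[n --> \oo] --> (pi ^+ 2 / 8 : R).
Proof.
apply: (squeeze_cvgr (nearW _ (odd_invsq_sum_bounds R))); last exact: cvg_cst.
rewrite -[X in _ --> X]subr0; apply: cvgB; first exact: cvg_cst.
rewrite -(mulr0 (pi ^+ 2 / 16)); apply: cvgM; first exact: cvg_cst.
under eq_fun do rewrite -exprVn.
by apply: cvg_expr; rewrite ger0_norm ?invf_lt1 ?invr_ge0// ltr1n.
Qed.

(** The even terms up to 2m are a quarter of the terms up to m. *)
Lemma invsq_sum_double (R : realType) (m : nat) :
  invsq_sum R m.*2 = odd_invsq_sum R m + invsq_sum R m / 4.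
Proof.
rewrite /invsq_sum /odd_invsq_sum; elim: m => [|m IHm].
  by rewrite !big_geq// mul0r addr0.
rewrite doubleS big_nat_recr// big_nat_recr//= IHm.
rewrite [in RHS]big_nat_recr// [X in _ = _ + X / 4]big_nat_recr//=.
have -> : m.*2.+2%:R = 2 * m.+1%:R :> R by rewrite -natrM mul2n doubleS.
have m0 : m.+1%:R != 0 :> R by rewrite pnatr_eq0.
have w0 : m.*2.+1%:R != 0 :> R by rewrite pnatr_eq0.
move: (_%:R) m0 (_%:R) w0 => a a0 w w0.
by field; rewrite a0 w0.
Qed.

(** * Convergence of series with nonnegative terms *)

Lemma nondecreasing_psum (R : realType) (f : nat -> R) :
  (forall t, (1 <= t)%N -> 0 <= f t) ->
  nondecreasing_seq (fun T => \sum_(1 <= t < T.+1) f t).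
Proof.
move=> f0; apply/nondecreasing_seqP => n.
by rewrite [leRHS]big_nat_recr//= lerDl f0.
Qed.

Lemma is_cvg_psum (R : realType) (f : nat -> R) (M : R) :
  (forall t, (1 <= t)%N -> 0 <= f t) ->
  (forall T, \sum_(1 <= t < T.+1) f t <= M) ->
  cvgn (fun T => \sum_(1 <= t < T.+1) f t).
Proof.
move=> f0 fM; apply: nondecreasing_is_cvgn; first exact: nondecreasing_psum.
by exists M => _ [n _ <-]; exact: fM.
Qed.

Lemma invsq_sum_le2 (R : realType) (n : nat) : invsq_sum R n <= 2.
Proof.
(* The induction carries the sharper bound 2 - 1/n: the decrease 1/z - 1/(z+1) of the reciprocal
   dominates 1/(z+1)^2. *)
suff h m : invsq_sum R m.+1 <= 2 - (m.+1%:R)^-1.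
  case: n => [|n]; first by rewrite /invsq_sum big_geq.
  by apply: le_trans (h n) _; rewrite gerBl invr_ge0.
elim: m => [|m IHm]; first by rewrite /invsq_sum big_nat1 expr1n invr1; lra.
rewrite /invsq_sum big_nat_recr//= -/(invsq_sum R m.+1).
apply: le_trans (lerD IHm (lexx _)) _.
rewrite -(natr1 m.+1); set z : R := m.+1%:R.
have z0 : 0 < z by rewrite ltr0n.
have z1 : 0 < z + 1 by lra.
rewrite -subr_ge0.
rewrite -[leRHS](_ : z^-1 - (z + 1)^-1 - ((z + 1) ^+ 2)^-1 = _); last by ring.
have -> : z^-1 - (z + 1)^-1 - ((z + 1) ^+ 2)^-1 = (z * (z + 1) ^+ 2)^-1.
  by field; rewrite !gt_eqF.
by rewrite invr_ge0 mulr_ge0 ?exprn_ge0// ltW.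
Qed.

Lemma is_cvg_invsq_sum (R : realType) : cvgn (@invsq_sum R).
Proof.
apply: (@is_cvg_psum _ _ 2) => [t _|]; last exact: invsq_sum_le2.
by rewrite invr_ge0 exprn_ge0.
Qed.

(** Along the powers of two, [invsq_sum_double] passes to the limit as Z = pi^2 / 8 + Z / 4. *)
Lemma basel (R : realType) : limn (@invsq_sum R) = pi ^+ 2 / 6.
Proof.
set Z := limn _; have cZ : @invsq_sum R @ \oo --> Z := @is_cvg_invsq_sum R.
have sub : invsq_sum R (2 ^ n) @[n --> \oo] --> Z.
  apply: cvg_comp cZ; apply/cvgnyPge => M; near=> n.
  apply: (@leq_trans n); last by rewrite ltnW// ltn_expl.
  near: n; exact: nbhs_infty_ge.
have subS : invsq_sum R (2 ^ n.+1) @[n --> \oo] --> Z.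
  by have := sub; rewrite -(cvg_shiftS (fun n => invsq_sum R (2 ^ n))).
have : invsq_sum R (2 ^ n.+1) @[n --> \oo] --> pi ^+ 2 / 8 + Z / 4.
  under eq_fun do rewrite expnS mul2n invsq_sum_double.
  by apply: cvgD; [exact: cvg_odd_invsq_sum|apply: cvgM;
    [exact: sub|exact: cvg_cst]].
move=> /(cvg_unique _ subS) => /(_ (@norm_hausdorff _ _)).
by lra.
Unshelve. all: by end_near. Qed.

(** * Smallest eigenvalue of a symmetric matrix of size 2 *)

(** Off the diagonal only [M 0 1] is read, so this is the quadratic form of M when M is symmetric;
    [bf] is its polarisation. *)
Definition qf (R : realType) (M : 'M[R]_2) (x y : R) : R :=
  M 0 0 * x ^+ 2 + 2 * M 0 1 * x * y + M 1 1 * y ^+ 2.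

Definition bf (R : realType) (M : 'M[R]_2) (x y z w : R) : R :=
  M 0 0 * x * z + M 0 1 * (x * w + y * z) + M 1 1 * y * w.

Lemma ord2E (i : 'I_2) : i = 0 \/ i = 1.
Proof. by case: i => [[|[|]]]// ?; [left|right]; exact: val_inj. Qed.

Lemma det2E (R : comNzRingType) (M : 'M[R]_2) :
  \det M = M 0 0 * M 1 1 - M 0 1 * M 1 0.
Proof.
rewrite (expand_det_row M 0) !big_ord_recl big_ord0 addr0.
rewrite /cofactor !det_mx11 !mxE/= expr0 mul1r expr1 mulN1r mulrN.
by congr (M _ _ * M _ _ - M _ _ * M _ _); apply/val_inj.
Qed.

Lemma trace2E (R : nzRingType) (M : 'M[R]_2) : \tr M = M 0 0 + M 1 1.
Proof. by rewrite /mxtrace !big_ord_recl big_ord0 addr0; congr (M _ _ + M _ _);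
  apply/val_inj. Qed.

Lemma eigenvalue2E (R : fieldType) (M : 'M[R]_2) (a : R) :
  eigenvalue M a = ((M 0 0 - a) * (M 1 1 - a) - M 0 1 * M 1 0 == 0).
Proof.
rewrite eigenvalue_root_char /root /char_poly -horner_evalE -det_map_mx det2E.
rewrite !mxE/= !horner_evalE !hornerE/=.
apply/eqP/eqP => <-; ring.
Qed.

Section symmetric2.
Context (R : realType).
Implicit Types (M N : 'M[R]_2).

(** Lying below both diagonal entries singles out the smaller root: any a < l makes the product of
    differences strictly larger than [M 0 1 ^+ 2]. *)
Lemma lambda_min_eq M l : M 1 0 = M 0 1 ->
  (M 0 0 - l) * (M 1 1 - l) = M 0 1 ^+ 2 -> l <= M 0 0 -> l <= M 1 1 ->
  lambda_min M = l.
Proof.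
move=> sM e la lc.
have El : eigenvalue M l by rewrite eigenvalue2E sM e expr2 subrr.
have lb : lbound [set a : R | eigenvalue M a] l.
  move=> a /=; rewrite eigenvalue2E sM => /eqP ea; rewrite leNgt;
    apply/negP => al.
  have : 0 < (M 0 0 - a) * (M 1 1 - a) - (M 0 0 - l) * (M 1 1 - l).
    rewrite -[ltRHS](_ : (l - a) * ((M 0 0 - l) + (M 1 1 - l) + (l - a)) = _);
      last by ring.
    by apply: mulr_gt0; lra.
  rewrite e; lra.
apply/eqP; rewrite eq_le; apply/andP; split.
  by apply: ge_inf => //; exists l.
by apply: lb_le_inf => //; exists l.
Qed.

Lemma lambda_min_char M : M 1 0 = M 0 1 ->
  [/\ (M 0 0 - lambda_min M) * (M 1 1 - lambda_min M) = M 0 1 ^+ 2,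
      lambda_min M <= M 0 0 & lambda_min M <= M 1 1].
Proof.
move=> sM; set a := M 0 0; set c := M 1 1; set b := M 0 1.
pose d := Num.sqrt ((a - c) ^+ 2 + 4 * b ^+ 2).
have d2 : d ^+ 2 = (a - c) ^+ 2 + 4 * b ^+ 2.
  rewrite sqr_sqrtr//; apply: addr_ge0; first exact: sqr_ge0.
  by apply: mulr_ge0 => //; exact: sqr_ge0.
have d0 : 0 <= d by exact: sqrtr_ge0.
have b20 : 0 <= b ^+ 2 by exact: sqr_ge0.
have dac : `|a - c| <= d.
  by rewrite -(@ler_pXn2r _ 2) ?nnegrE// d2 real_normK ?num_real//; lra.
have /andP[dac1 dac2] : - d <= a - c <= d by rewrite -ler_norml.
pose l := (a + c - d) / 2.
have h : (a - l) * (c - l) = b ^+ 2.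
  rewrite (_ : (a - l) * (c - l) = (d ^+ 2 - (a - c) ^+ 2) / 4);
    last by rewrite /l; field.
  by rewrite d2; lra.
have la : l <= a by rewrite /l; lra.
have lc : l <= c by rewrite /l; lra.
by rewrite (lambda_min_eq sM h la lc); split.
Qed.

(** With l the smallest eigenvalue, M - l I has determinant zero; multiplied by c - l > 0, its form
    becomes a perfect square. If c = l, then b = 0. *)
Lemma lambda_min_le_qf M x y : M 1 0 = M 0 1 ->
  lambda_min M * (x ^+ 2 + y ^+ 2) <= qf M x y.
Proof.
move=> sM; have [e la lc] := lambda_min_char sM.
move: e la lc; rewrite /qf; move: (M 0 0) (M 0 1) (M 1 1) (lambda_min M).
move=> a b c l e la lc; rewrite -subr_ge0.
have [cl|cl] := eqVneq c l.
  have b0 : b = 0 by apply/eqP; rewrite -sqrf_eq0 -e cl subrr mulr0.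
  rewrite b0 cl -[leRHS](_ : (a - l) * x ^+ 2 = _); last by ring.
  by rewrite mulr_ge0 ?sqr_ge0 ?subr_ge0.
have {}lc : 0 < c - l by rewrite subr_gt0 lt_neqAle eq_sym cl.
rewrite -(pmulr_rge0 _ lc).
rewrite -[leRHS](_ : ((a - l) * (c - l) - b ^+ 2) * x ^+ 2 +
  (b * x + (c - l) * y) ^+ 2 = _); last by ring.
by rewrite e subrr mul0r add0r sqr_ge0.
Qed.

Lemma lambda_min_attained M : M 1 0 = M 0 1 ->
  exists x y, 0 < x ^+ 2 + y ^+ 2 /\
    qf M x y = lambda_min M * (x ^+ 2 + y ^+ 2).
Proof.
move=> sM; have [e la lc] := lambda_min_char sM.
move: e la lc; rewrite /qf; move: (M 0 0) (M 0 1) (M 1 1) (lambda_min M).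
move=> a b c l e la lc; have [cl|cl] := eqVneq c l.
  have b0 : b = 0 by apply/eqP; rewrite -sqrf_eq0 -e cl subrr mulr0.
  by exists 0, 1; rewrite b0 cl; split; [rewrite expr0n expr1n add0r|ring].
(* This vector is in the kernel of M - l I, whose determinant vanishes, and is nonzero as c differs
   from l. *)
exists (c - l), (- b); split.
  rewrite ltr_pwDl ?sqr_ge0// exprn_even_gt0//= subr_eq0//.
apply/eqP; rewrite -subr_eq0; apply/eqP.
rewrite -[LHS](_ : (c - l) * ((a - l) * (c - l) - b ^+ 2) = _); last by ring.
by rewrite e subrr mulr0.
Qed.

Lemma le_lambda_min M m : M 1 0 = M 0 1 ->
  (forall x y, m * (x ^+ 2 + y ^+ 2) <= qf M x y) -> m <= lambda_min M.
Proof.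
move=> sM qm; have [x [y [xy0 e]]] := lambda_min_attained sM.
by have := qm x y; rewrite e ler_pM2r.
Qed.

Lemma lambda_min_gt0 M : M 1 0 = M 0 1 ->
  (forall x y, 0 < x ^+ 2 + y ^+ 2 -> 0 < qf M x y) -> 0 < lambda_min M.
Proof.
move=> sM qM; have [x [y [xy0 e]]] := lambda_min_attained sM.
by have := qM x y xy0; rewrite e pmulr_lgt0.
Qed.

(** The trace minus [lambda_min M] is the other eigenvalue. *)
Lemma det_lambda_min M : M 1 0 = M 0 1 ->
  \det M = lambda_min M * (\tr M - lambda_min M).
Proof.
move=> sM; have [e _ _] := lambda_min_char sM.
rewrite det2E trace2E sM -expr2 -e; ring.
Qed.

Lemma lambda_min_unitmx M : M 1 0 = M 0 1 -> 0 < lambda_min M -> M \in unitmx.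
Proof.
move=> sM l0; have [_ la lc] := lambda_min_char sM.
rewrite unitmxE det_lambda_min// unitfE mulf_neq0// ?gt_eqF//.
by rewrite trace2E; lra.
Qed.

Lemma unitmx_lambda_min_neq0 M : M 1 0 = M 0 1 -> M \in unitmx ->
  lambda_min M != 0.
Proof.
move=> sM; rewrite unitmxE det_lambda_min// unitfE mulf_eq0 negb_or.
by case/andP.
Qed.

Lemma trace_invmx2 M : M 1 0 = M 0 1 -> 0 < lambda_min M ->
  \tr (invmx M) = (lambda_min M)^-1 + (\tr M - lambda_min M)^-1.
Proof.
move=> sM l0; have uM := lambda_min_unitmx sM l0.
have [_ la lc] := lambda_min_char sM.
have m0 : 0 < \tr M - lambda_min M by rewrite trace2E; lra.
rewrite /invmx uM mxtraceZ det_lambda_min//.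
(* In size 2 the adjugate exchanges the diagonal entries. *)
have -> : \tr (\adj M) = \tr M.
  rewrite !trace2E !mxE /cofactor !det_mx11 !mxE addrC.
  by congr (_ + _); rewrite /= ?expr0 ?expr2 ?mulrNN ?mul1r; congr (M _ _);
    apply/val_inj.
by field; rewrite !gt_eqF.
Qed.

Lemma lambda_minZ k M : M 1 0 = M 0 1 -> 0 <= k ->
  lambda_min (k *: M) = k * lambda_min M.
Proof.
move=> sM k0; have [e la lc] := lambda_min_char sM.
apply: lambda_min_eq; rewrite ?mxE ?sM ?ler_wpM2l//.
by rewrite -!mulrBr exprMn -e; ring.
Qed.

(* The characteristic equation of [M], written in the orthogonal basis
   [(p, r), (- r, p)]. *)
Lemma lambda_min_frame M p r : M 1 0 = M 0 1 ->
  (qf M p r - lambda_min M * (p ^+ 2 + r ^+ 2)) *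
    (qf M (- r) p - lambda_min M * (p ^+ 2 + r ^+ 2)) =
  bf M p r (- r) p ^+ 2.
Proof.
move=> sM; have [e _ _] := lambda_min_char sM; rewrite /qf /bf.
move: (M 0 0) (M 0 1) (M 1 1) (lambda_min M) e => a b c l e.
apply/eqP; rewrite -subr_eq0; apply/eqP.
rewrite -[LHS](_ : (p ^+ 2 + r ^+ 2) ^+ 2 * ((a - l) * (c - l) - b ^+ 2) = _);
  last by ring.
by rewrite e subrr mulr0.
Qed.

End symmetric2.

(** * Euclidean plane and weighted Gram matrices *)

(** The second vector is given by its coordinates, to match the arguments of [qf] and [bf]. *)
Definition dot2 (R : realType) (u : 'cV[R]_2) (x y : R) : R :=
  u 0 0 * x + u 1 0 * y.

Lemma qf_bf (R : realType) (M : 'M[R]_2) x y : qf M x y = bf M x y x y.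
Proof. by rewrite /qf /bf; ring. Qed.

Lemma enorm2E (R : realType) (u : 'cV[R]_2) :
  enorm u ^+ 2 = u 0 0 ^+ 2 + u 1 0 ^+ 2.
Proof.
rewrite /enorm sqr_sqrtr; last by apply: sumr_ge0 => i _; exact: sqr_ge0.
rewrite !big_ord_recl big_ord0 addr0.
by congr (u _ _ ^+ 2 + u _ _ ^+ 2); apply/val_inj.
Qed.

Lemma enorm_ge0 (R : realType) n (u : 'cV[R]_n) : 0 <= enorm u.
Proof. exact: sqrtr_ge0. Qed.

(** Cauchy-Schwarz by Lagrange's identity: the squares differ by the squared cross product. *)
Lemma dot2_le (R : realType) (u v : 'cV[R]_2) :
  `|dot2 u (v 0 0) (v 1 0)| <= enorm u * enorm v.
Proof.
rewrite -(@ler_pXn2r _ 2) ?nnegrE ?mulr_ge0 ?enorm_ge0//.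
rewrite real_normK ?num_real// exprMn !enorm2E -subr_ge0 /dot2.
rewrite -[leRHS](_ : (u 0 0 * v 1 0 - u 1 0 * v 0 0) ^+ 2 = _) ?sqr_ge0//.
by ring.
Qed.

Lemma bf_outer (R : realType) (c : R) (u : 'cV[R]_2) x y z w :
  bf (c *: (u *m u^T)) x y z w = c * (dot2 u x y * dot2 u z w).
Proof.
rewrite /bf /dot2 !mxE !big_ord1 !mxE; ring.
Qed.

Lemma bf_sum (R : realType) I (r : seq I) (F : I -> 'M[R]_2) x y z w :
  bf (\sum_(i <- r) F i) x y z w = \sum_(i <- r) bf (F i) x y z w.
Proof.
apply: (big_morph (fun M => bf M x y z w)) => [M N|]; rewrite /bf !mxE; ring.
Qed.

(** * Uniform positive lower bounds *)

Lemma exists_uniform_gt0 (R : realType) (Q : nat) (P : 'I_Q -> R -> Prop) :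
  (forall q a b, b <= a -> P q a -> P q b) ->
  (forall q, exists2 a, 0 < a & P q a) -> exists2 a, 0 < a & forall q, P q a.
Proof.
move=> Pmono Pex.
have /choice[f fP] q : exists a, 0 < a /\ P q a by have [a] := Pex q; exists a.
(* The default 1 keeps the minimum positive when there is no station. *)
exists (\big[Num.min/1]_q f q); last first.
  by move=> q; apply: Pmono (fP q).2; exact: bigmin_le.
by apply: lt_bigmin => // q _; exact: (fP q).1.
Qed.

(** Going down from n0, each step absorbs one more positive term into the lower bound c. *)
Lemma seq_lower_bound (R : realType) (u : nat -> R) (n0 : nat) (c : R) :
  0 < c -> (forall n, 0 < u n) -> (forall n, (n0 <= n)%N -> c <= u n) ->
  exists2 a, 0 < a & forall n, a < u n.
Proof.
elim: n0 c => [|n0 IH] c c0 u0 uc.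
  (* Halving makes the inequality strict. *)
  exists (c / 2); first by rewrite divr_gt0.
  by move=> n; apply: lt_le_trans (uc n _) => //; lra.
apply: (IH (Num.min c (u n0))) => //; first by rewrite lt_min c0 u0.
move=> n; rewrite leq_eqVlt => /predU1P[<-|nn]; rewrite ge_min ?lexx ?orbT//.
by rewrite uc.
Qed.

(** * Growth of the harmonic sum *)

Definition harmonic_sum (R : realType) (n : nat) : R :=
  \sum_(1 <= t < n.+1) t%:R^-1.

(* Cesaro's theorem is applied twice: first to [1/(n+1)], then to the
   increments of the squared partial sums. *)
Lemma cvg_harmonic_sum_sqr (R : realType) :
  harmonic_sum R n ^+ 2 / n%:R @[n --> \oo] --> (0 : R).
Proof.
have HE n : harmonic_sum R n = series harmonic n.
  by rewrite /harmonic_sum /series/= big_add1.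
have c1 : harmonic_sum R n.+1 / n.+1%:R @[n --> \oo] --> (0 : R).
  have := cesaro (@cvg_harmonic R); rewrite /arithmetic_mean.
  by under eq_fun do rewrite -HE mulrC.
pose u n := harmonic_sum R n.+1 ^+ 2 - harmonic_sum R n ^+ 2.
have uE n : u n = 2 * (harmonic_sum R n.+1 / n.+1%:R) - n.+1%:R^-1 * n.+1%:R^-1.
  rewrite /u {1}/harmonic_sum big_nat_recr//= -/(harmonic_sum R n).
  rewrite [in RHS]/harmonic_sum big_nat_recr//= -/(harmonic_sum R n).
  by ring.
have cu : u n @[n --> \oo] --> (0 : R).
  under eq_fun do rewrite uE.
  rewrite (_ : 0 = 2 * 0 - 0 * 0); last by rewrite !mulr0 subr0.
  apply: cvgB; first by apply: cvgM => //; exact: cvg_cst.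
  by apply: cvgM; exact: cvg_harmonic.
have := cesaro cu; rewrite /arithmetic_mean => c2.
rewrite -(cvg_shiftS (fun n => harmonic_sum R n ^+ 2 / n%:R)).
apply: cvg_trans c2; apply: near_eq_cvg; apply: nearW => n.
rewrite /= mulrC; congr (_ * _).
rewrite /series/= telescope_sumr// /harmonic_sum [X in _ - X ^+ 2]big_geq//.
by rewrite expr0n subr0.
Qed.

(** * Extremal station parameters *)

Lemma alpha_max2_ge (R : realType) (Q : nat) (alpha : 'I_Q -> R) q :
  alpha q ^+ 2 <= alpha_max2 alpha.
Proof.
apply: ub_le_sup; last by exists q.
case: (@arg_maxP _ _ _ q xpredT (fun q => alpha q ^+ 2)) => // i _ h.
by exists (alpha i ^+ 2) => _ [j _ <-]; exact: h.
Qed.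

Lemma sigma_min2_le (R : realType) (Q : nat) (sigma : 'I_Q -> R) q :
  sigma_min2 sigma <= sigma q ^+ 2.
Proof.
apply: ge_inf; last by exists q.
by exists 0 => _ [j _ <-]; exact: sqr_ge0.
Qed.

Lemma sigma_min2_gt0 (R : realType) (Q : nat) (sigma : 'I_Q -> R) (q : 'I_Q) :
  (forall q, 0 < sigma q) -> 0 < sigma_min2 sigma.
Proof.
move=> s0.
case: (@arg_minP _ _ _ q xpredT (fun q => sigma q ^+ 2)) => // i _ h.
apply: (@lt_le_trans _ _ (sigma i ^+ 2)); first exact: exprn_gt0.
by apply: lb_le_inf; [exists (sigma q ^+ 2), q|move=> _ [j _ <-]; exact: h].
Qed.

(** * Plane geometry relative to the direction v *)

Lemma enorm_gt0 (R : realType) (v : 'cV[R]_2) : v != 0 -> 0 < enorm v.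
Proof.
move=> v0; rewrite lt_def enorm_ge0 andbT -sqrf_eq0 enorm2E.
apply: contra v0; rewrite paddr_eq0 ?sqr_ge0// !sqrf_eq0 =>
  /andP[/eqP a /eqP b].
by apply/eqP/matrixP => i j; rewrite ord1 mxE; have [->|->] := ord2E i.
Qed.

Lemma free_cross (R : realType) (u v : 'cV[R]_2) : v != 0 ->
  free [:: u; v] -> dot2 u (- v 1 0) (v 0 0) != 0.
Proof.
move=> v0; rewrite free_cons span_seq1 => /andP[+ _]; apply: contra => /eqP h.
have vE : enorm v ^+ 2 != 0 by rewrite sqrf_eq0 gt_eqF// enorm_gt0.
(* If the cross product vanishes, u equals its orthogonal projection on v. *)
apply/vlineP; exists (dot2 u (v 0 0) (v 1 0) / enorm v ^+ 2).
apply/matrixP => i j; rewrite ord1 mxE mulrAC.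
apply/(mulIf vE); rewrite mulfVK// enorm2E.
move: h; rewrite /dot2 => h.
have [->|->] := ord2E i; apply/eqP; rewrite -subr_eq0.
  rewrite -[X in X == _](_ : - (u 0 0 * - v 1 0 + u 1 0 * v 0 0) * v 1 0 = _);
    last by ring.
  by rewrite h oppr0 mul0r.
rewrite -[X in X == _](_ : (u 0 0 * - v 1 0 + u 1 0 * v 0 0) * v 0 0 = _);
  last by ring.
by rewrite h mul0r.
Qed.

(** [proj_perp v] keeps only the component along the rotation of v by a right angle, a vector of
    norm |v|. *)
Lemma enorm_proj_perp (R : realType) (v l : 'cV[R]_2) : v != 0 ->
  enorm (proj_perp v *m l) ^+ 2 = dot2 l (- v 1 0) (v 0 0) ^+ 2 / enorm v ^+ 2.
Proof.
move=> v0; have : enorm v ^+ 2 != 0 by rewrite sqrf_eq0 gt_eqF// enorm_gt0.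
rewrite [enorm (_ *m _) ^+ 2]enorm2E /proj_perp mulmxBl mul1mx -scalemxAl
  -mulmxA.
have -> : v^T *m l = (dot2 l (v 0 0) (v 1 0))%:M.
  apply/matrixP => i j; rewrite !ord1 !mxE big_ord_recl big_ord1 !mxE mulr1n.
  rewrite /dot2 mulrC; congr (_ + _); rewrite mulrC.
  by congr (l _ _ * v _ _); apply/val_inj.
rewrite mul_mx_scalar !mxE enorm2E /dot2 => vE; field.
by rewrite vE.
Qed.

Section gram.
Context (R : realType) (Q : nat).
Implicit Types (w : nat -> 'I_Q -> R) (r : nat -> 'I_Q -> 'cV[R]_2).

(** Common shape of [A_v] and [fisher_v], which unfold to it with different weights. *)
Definition gram w r (T : nat) : 'M[R]_2 :=
  \sum_(1 <= t < T.+1) \sum_(q < Q) w t q *: (r t q *m (r t q)^T).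

Lemma bf_gram w r T x y z u : bf (gram w r T) x y z u =
  \sum_(1 <= t < T.+1) \sum_(q < Q)
     w t q * (dot2 (r t q) x y * dot2 (r t q) z u).
Proof.
rewrite /gram bf_sum; apply: eq_bigr => t _.
by rewrite bf_sum; apply: eq_bigr => q _; rewrite bf_outer.
Qed.

Lemma qf_gram w r T x y : qf (gram w r T) x y =
  \sum_(1 <= t < T.+1) \sum_(q < Q) w t q * dot2 (r t q) x y ^+ 2.
Proof. by rewrite qf_bf bf_gram. Qed.

Lemma gram_sym w r T : gram w r T 1 0 = gram w r T 0 1.
Proof.
rewrite /gram !summxE; apply: eq_bigr => t _.
rewrite !summxE; apply: eq_bigr => q _.
by rewrite !mxE !big_ord1 !mxE [_ * r t q 0 0]mulrC.
Qed.

Lemma qf_gram_le w w' r T k x y :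
  (forall t q, (1 <= t)%N -> w t q <= k * w' t q) ->
  qf (gram w r T) x y <= k * qf (gram w' r T) x y.
Proof.
move=> ww'; rewrite !qf_gram big_distrr/= !big_nat.
apply: ler_sum => t /andP[t1 _]; rewrite big_distrr/=; apply: ler_sum => q _.
by rewrite mulrA ler_wpM2r ?sqr_ge0 ?ww'.
Qed.

Lemma gram_lambda_min_ge0 w r T :
  (forall t q, (1 <= t)%N -> 0 <= w t q) -> 0 <= lambda_min (gram w r T).
Proof.
move=> w0; apply: le_lambda_min; first exact: gram_sym.
move=> x y; rewrite mul0r qf_gram big_nat; apply: sumr_ge0 => t /andP[t1 _].
by apply: sumr_ge0 => q _; rewrite mulr_ge0 ?sqr_ge0 ?w0.
Qed.

(** At station q0, times 1 and 2 already contribute two squares that vanish together only at the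
    origin; all other terms are nonnegative. *)
Lemma gram_lambda_min_gt0 w r T q0 : (2 <= T)%N ->
  (forall t q, (1 <= t)%N -> 0 <= w t q) ->
  (forall t, (1 <= t)%N -> 0 < w t q0) ->
  (forall x y, dot2 (r 1%N q0) x y = 0 -> dot2 (r 2%N q0) x y = 0 ->
     x = 0 /\ y = 0) ->
  0 < lambda_min (gram w r T).
Proof.
move=> T2 w0 wq0 rfree; apply: lambda_min_gt0; first exact: gram_sym.
move=> x y xy0; rewrite qf_gram.
pose s t := \sum_(q < Q) w t q * dot2 (r t q) x y ^+ 2.
have s0 t q : (1 <= t)%N -> 0 <= w t q * dot2 (r t q) x y ^+ 2.
  by move=> t1; rewrite mulr_ge0 ?sqr_ge0 ?w0.
have sq t : (1 <= t)%N -> w t q0 * dot2 (r t q0) x y ^+ 2 <= s t.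
  move=> t1; rewrite /s (bigD1 q0)//= lerDl; apply: sumr_ge0 => q _.
  exact: s0.
have s12 : s 1%N + s 2%N <= \sum_(1 <= t < T.+1) s t.
  rewrite big_ltn ?ltnS ?(ltnW T2)// big_ltn ?ltnS// addrA lerDl big_nat;
    apply: sumr_ge0.
  move=> t /andP[t3 _]; apply: sumr_ge0 => q _; apply: s0.
  exact: leq_trans t3.
apply: lt_le_trans s12.
have := sq 1%N isT; have := sq 2%N isT; have := s0 1%N q0 isT;
  have := s0 2%N q0 isT.
have [p1|p1] := eqVneq (dot2 (r 1%N q0) x y) 0; last first.
  have := mulr_gt0 (wq0 1%N isT) (_ : 0 < dot2 (r 1%N q0) x y ^+ 2).
  by rewrite exprn_even_gt0//= p1 => /(_ isT); lra.
have [p2|p2] := eqVneq (dot2 (r 2%N q0) x y) 0; last first.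
  have := mulr_gt0 (wq0 2%N isT) (_ : 0 < dot2 (r 2%N q0) x y ^+ 2).
  by rewrite exprn_even_gt0//= p2 => /(_ isT); lra.
have [x0 y0] := rfree _ _ p1 p2.
by move: xy0; rewrite x0 y0 expr0n/= addr0 ltxx.
Qed.

End gram.

(** * Asymptotics along the trajectory *)

Section trajectory.
Context (R : realType) (Q : nat) (x v : 'cV[R]_2) (o : 'I_Q -> 'cV[R]_2).
Hypothesis v_neq0 : v != 0.
Hypothesis dist_gt0 : forall q t, (1 <= t)%N -> 0 < dist x v o t q.

Let weight t q : R := t%:R ^+ 2 / dist x v o t q ^+ 4.

(* Signed component of the offset orthogonal to [v], scaled by [enorm v]. *)
Let cross q := dot2 (offset x o q) (- v 1 0) (v 0 0).

Let v2_gt0 : 0 < enorm v ^+ 2.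
Proof. by rewrite exprn_gt0// enorm_gt0. Qed.

Lemma A_v_gram T : A_v x v o T = gram weight (relpos x v o) T.
Proof. by []. Qed.

Lemma A_v_sym T : A_v x v o T 1 0 = A_v x v o T 0 1.
Proof. by rewrite A_v_gram gram_sym. Qed.

Lemma dot2_relpos t q y z :
  dot2 (relpos x v o t q) y z = dot2 (offset x o q) y z + t%:R * dot2 v y z.
Proof. by rewrite /dot2 /relpos !mxE; ring. Qed.

(** v is orthogonal to its own rotation, so the transverse component does not change with time. *)
Lemma dot2_relpos_perp t q : dot2 (relpos x v o t q) (- v 1 0) (v 0 0) =
  cross q.
Proof.
rewrite dot2_relpos (_ : dot2 v _ _ = 0) ?mulr0 ?addr0// /dot2; ring.
Qed.

Lemma weight_gt0 t q : (1 <= t)%N -> 0 < weight t q.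
Proof.
by move=> t1; rewrite divr_gt0 ?exprn_gt0 ?dist_gt0 ?ltr0n.
Qed.

Lemma enorm_relpos2 t q : dist x v o t q ^+ 2 =
  enorm (offset x o q) ^+ 2 + 2 * t%:R * dot2 (offset x o q) (v 0 0) (v 1 0)
  + t%:R ^+ 2 * enorm v ^+ 2.
Proof. by rewrite /dist !enorm2E /dot2 /relpos !mxE; ring. Qed.

Lemma dist_upper q : exists2 c, 0 < c &
  forall t, (1 <= t)%N -> dist x v o t q ^+ 2 <= c * t%:R ^+ 2.
Proof.
exists (2 * enorm (offset x o q) ^+ 2 + 2 * enorm v ^+ 2).
  by apply: ltr_wpDl; [apply: mulr_ge0 => //; exact: sqr_ge0|exact: mulr_gt0].
move=> t t1; have t2 : 1 <= t%:R ^+ 2 :> R by rewrite exprn_ege1// ler1n.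
have l0 : 0 <= enorm (offset x o q) ^+ 2 by exact: sqr_ge0.
apply: (@le_trans _ _ (2 * enorm (offset x o q) ^+ 2 +
  2 * (t%:R ^+ 2 * enorm v ^+ 2))).
  rewrite enorm_relpos2 !enorm2E /dot2 -subr_ge0.
  set l := offset x o q.
  (* The gap is |l - t v|^2. *)
  rewrite -[leRHS](_ : (l 0 0 - t%:R * v 0 0) ^+ 2 +
    (l 1 0 - t%:R * v 1 0) ^+ 2 = _); last by ring.
  by rewrite addr_ge0 ?sqr_ge0.
have : 2 * enorm (offset x o q) ^+ 2 * 1 <=
    2 * enorm (offset x o q) ^+ 2 * t%:R ^+ 2.
  by rewrite ler_wpM2l// mulr_ge0.
lra.
Qed.

Lemma dist_lower_at q : exists2 rho, 0 < rho &
  forall t, (1 <= t)%N -> rho * t%:R < dist x v o t q.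
Proof.
set l := offset x o q.
(* For t = n + 1 with n >= n0, |l| <= t |v| / 2, so the distance is at least t |v| / 2. *)
pose n0 := Num.trunc (4 * enorm l ^+ 2 / enorm v ^+ 2).
(* Times are shifted by one, since the distance may vanish at t = 0. *)
have [rho rho0 h] : exists2 a, 0 < a & forall n,
    a < dist x v o n.+1 q / n.+1%:R.
  apply: (@seq_lower_bound _ _ n0 (enorm v / 2)).
  - by rewrite divr_gt0 ?enorm_gt0.
  - by move=> n; rewrite divr_gt0 ?dist_gt0 ?ltr0n.
  move=> n n0n; rewrite ler_pdivlMr ?ltr0n//.
  have v0 := enorm_gt0 v_neq0.
  rewrite -(@ler_pXn2r _ 2) ?nnegrE ?mulr_ge0 ?(ltW v0) ?invr_ge0 ?enorm_ge0//.
  have n1 : 1 <= n.+1%:R :> R by rewrite ler1n.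
  have : 4 * enorm l ^+ 2 / enorm v ^+ 2 <= n.+1%:R ^+ 2.
    apply: (@le_trans _ _ n.+1%:R); last by rewrite expr2 ler_peMl.
    apply/ltW/(lt_le_trans (truncnS_gt _)).
    by rewrite ler_nat ltnS.
  rewrite ler_pdivrMr// => hl.
  rewrite enorm_relpos2 -/l exprMn exprMn -subr_ge0.
  (* Expanding |2 l + t v|^2 >= 0 bounds the mixed term of the squared distance from below. *)
  have : 0 <= (2 * l 0 0 + n.+1%:R * v 0 0) ^+ 2 +
      (2 * l 1 0 + n.+1%:R * v 1 0) ^+ 2 by rewrite addr_ge0 ?sqr_ge0.
  move: hl; rewrite !enorm2E /dot2; nra.
exists rho => // -[//|t] _; have := h t.
by rewrite ltr_pdivlMr ?ltr0n.
Qed.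

Lemma dist_lower : exists2 rho : R, 0 < rho &
  forall q t, (1 <= t)%N -> rho * t%:R < dist x v o t q.
Proof.
apply: (@exists_uniform_gt0 R Q (fun q rho =>
  forall t, (1 <= t)%N -> rho * t%:R < dist x v o t q));
    last exact: dist_lower_at.
move=> q a b ba h t t1; apply: le_lt_trans (h t t1).
by rewrite ler_wpM2r.
Qed.

(** * Bounds under a linear lower bound on the distance *)

Section s2_bound.
Variables (q : 'I_Q) (rho : R).
Hypothesis rho_gt0 : 0 < rho.
Hypothesis rho_dist : forall t, (1 <= t)%N -> rho * t%:R < dist x v o t q.

Lemma weight_le t : (1 <= t)%N -> weight t q <= (rho ^+ 4)^-1 * (t%:R ^+ 2)^-1.
Proof.
move=> t1; have t0 : 0 < t%:R :> R by rewrite ltr0n.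
rewrite /weight ler_pdivrMr ?exprn_gt0 ?dist_gt0//.
rewrite -[leLHS](_ : (rho ^+ 4)^-1 * (t%:R ^+ 2)^-1 * (rho * t%:R) ^+ 4 = _);
  last first.
  by field; rewrite !gt_eqF.
rewrite ler_wpM2l ?mulr_ge0 ?invr_ge0 ?exprn_ge0 ?(ltW rho_gt0)//.
by rewrite lerXn2r// ?nnegrE ?mulr_ge0 ?(ltW rho_gt0) ?(ltW (dist_gt0 _ _))//
  ltW// rho_dist.
Qed.

Lemma s2_le T : s2 x v o q T <= (rho ^+ 4)^-1 * invsq_sum R T.
Proof.
rewrite /s2 /invsq_sum big_distrr/= !big_nat; apply: ler_sum => t /andP[t1 _].
exact: weight_le.
Qed.

Lemma is_cvg_s2_of_bound : cvgn (s2 x v o q).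
Proof.
apply: (@is_cvg_psum _ _ ((rho ^+ 4)^-1 * 2)).
  by move=> t t1; apply/ltW/weight_gt0.
move=> T; apply: le_trans (s2_le T) _.
by rewrite ler_wpM2l ?invsq_sum_le2// invr_ge0 exprn_ge0// ltW.
Qed.

Lemma s2_inf_le : s2_inf x v o q <= (rho ^+ 4)^-1 * limn (@invsq_sum R).
Proof.
have c : (rho ^+ 4)^-1 * invsq_sum R T @[T --> \oo] -->
    (rho ^+ 4)^-1 * limn (@invsq_sum R).
  by apply: cvgM; [exact: cvg_cst|exact: is_cvg_invsq_sum].
apply: (ler_cvg_to is_cvg_s2_of_bound c).
by apply: nearW; exact: s2_le.
Qed.

End s2_bound.

Lemma is_cvg_s2 q : cvgn (s2 x v o q).
Proof. by have [rho rho0 h] := dist_lower_at q;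
  exact: is_cvg_s2_of_bound h. Qed.

Lemma s2_le_inf q T : s2 x v o q T <= s2_inf x v o q.
Proof.
apply: nondecreasing_cvgn_le; last exact: is_cvg_s2.
by apply: nondecreasing_psum => t t1; apply/ltW/weight_gt0.
Qed.

Lemma s2_inf_gt0 q : 0 < s2_inf x v o q.
Proof.
apply: lt_le_trans (s2_le_inf q 1).
by rewrite /s2 big_nat1; apply: weight_gt0.
Qed.

(** By [enorm_proj_perp], this is |v|^2 times the sum over the stations in [C_v]. *)
Let L := \sum_(q < Q) s2_inf x v o q * cross q ^+ 2.

Lemma qf_perp T : qf (A_v x v o T) (- v 1 0) (v 0 0) =
  \sum_(q < Q) s2 x v o q T * cross q ^+ 2.
Proof.
rewrite A_v_gram qf_gram exchange_big/=; apply: eq_bigr => q _.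
by rewrite /s2 big_distrl/=; apply: eq_bigr => t _; rewrite dot2_relpos_perp.
Qed.

Lemma cvg_qf_perp : qf (A_v x v o T) (- v 1 0) (v 0 0) @[T --> \oo] --> L.
Proof.
under eq_fun do rewrite qf_perp.
apply: cvg_big => [|q _]; first exact: add_continuous.
 apply: cvgM; last exact: cvg_cst.
exact: is_cvg_s2.
Qed.

Lemma qf_perp_le T : qf (A_v x v o T) (- v 1 0) (v 0 0) <= L.
Proof.
rewrite qf_perp; apply: ler_sum => q _; rewrite ler_wpM2r ?sqr_ge0//.
exact: s2_le_inf.
Qed.

(** Cauchy-Schwarz bounds each summand by t^2 |v| |cross q| / d^3, and d > rho t turns this into a
    multiple of 1 / t. *)
Lemma bf_cross_le : exists K : R, forall T,
  `|bf (A_v x v o T) (v 0 0) (v 1 0) (- v 1 0) (v 0 0)| <= K * harmonic_sum R T.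
Proof.
have [rho rho0 rd] := dist_lower.
exists (\sum_(q < Q) (rho ^+ 3)^-1 * enorm v * `|cross q|) => T.
rewrite A_v_gram bf_gram; apply: le_trans (ler_norm_sum _ _ _) _.
rewrite /harmonic_sum big_distrr/= !big_nat; apply: ler_sum => t /andP[t1 _].
apply: le_trans (ler_norm_sum _ _ _) _; rewrite big_distrl/=.
apply: ler_sum => q _;
  rewrite dot2_relpos_perp normrM [X in X * _]gtr0_norm ?weight_gt0//.
rewrite normrM mulrA [leRHS]mulrAC ler_wpM2r//.
have d0 := dist_gt0 q t1; have t0 : 0 < t%:R :> R by rewrite ltr0n.
apply: (@le_trans _ _ (weight t q * (dist x v o t q * enorm v))).
  by rewrite ler_wpM2l ?dot2_le// ltW// weight_gt0.
rewrite -[leLHS](_ : t%:R ^+ 2 / dist x v o t q ^+ 3 * enorm v = _); last first.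
  by rewrite /weight; field; rewrite gt_eqF.
rewrite [leRHS]mulrAC ler_wpM2r ?enorm_ge0//.
rewrite ler_pdivrMr ?exprn_gt0//.
rewrite -[leLHS](_ : (rho ^+ 3)^-1 / t%:R * (rho * t%:R) ^+ 3 = _); last first.
  by field; rewrite !gt_eqF.
rewrite ler_wpM2l ?mulr_ge0 ?invr_ge0 ?exprn_ge0 ?(ltW rho0)//.
by rewrite lerXn2r// ?nnegrE ?mulr_ge0 ?(ltW rho0) ?(ltW d0)// ltW// rd.
Qed.

(** The trace is invariant under rotation, and both frame vectors have norm |v|. *)
Lemma qf_frame_trace (M : 'M[R]_2) :
  qf M (v 0 0) (v 1 0) + qf M (- v 1 0) (v 0 0) = \tr M * enorm v ^+ 2.
Proof. by rewrite trace2E enorm2E /qf; ring. Qed.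

Lemma trace_A_v T :
  \tr (A_v x v o T) =
  \sum_(1 <= t < T.+1) \sum_(q < Q) weight t q * dist x v o t q ^+ 2.
Proof.
rewrite /A_v raddf_sum; apply: eq_bigr => t _.
rewrite raddf_sum; apply: eq_bigr => q _.
rewrite /= mxtraceZ trace2E !mxE !big_ord1 !mxE /dist enorm2E.
by rewrite /relpos /offset !mxE -!expr2.
Qed.

(** Station q0 alone contributes t^2 / d^2 at each time, which is at least 1 / c by [dist_upper]. *)
Lemma trace_A_v_ge (q0 : 'I_Q) : exists2 k, 0 < k &
  forall T, k * T%:R <= \tr (A_v x v o T).
Proof.
have [c c0 hc] := dist_upper q0; exists c^-1; first by rewrite invr_gt0.
move=> T; rewrite trace_A_v.
have -> : c^-1 * T%:R = \sum_(1 <= t < T.+1) c^-1.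
  by rewrite sumr_const_nat subn1 mulr_natr.
rewrite !big_nat; apply: ler_sum => t /andP[t1 _].
have t0 : 0 < t%:R :> R by rewrite ltr0n.
rewrite (bigD1 q0)//=;
  apply: (@le_trans _ _ (weight t q0 * dist x v o t q0 ^+ 2)).
  have d0 := dist_gt0 q0 t1.
  rewrite -[leRHS](_ : t%:R ^+ 2 / dist x v o t q0 ^+ 2 = _); last first.
    by rewrite /weight; field; rewrite gt_eqF.
  rewrite ler_pdivlMr ?exprn_gt0// mulrC ler_pdivrMr// mulrC.
  exact: hc.
rewrite lerDl; apply: sumr_ge0 => q _.
by rewrite mulr_ge0 ?sqr_ge0// ltW// weight_gt0.
Qed.

Lemma lambda_min_A_v_le T : lambda_min (A_v x v o T) * enorm v ^+ 2 <= L.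
Proof.
apply: le_trans (qf_perp_le T).
have := lambda_min_le_qf (- v 1 0) (v 0 0) (A_v_sym T).
by rewrite sqrrN addrC -enorm2E.
Qed.

Lemma cvg_lambda_min_A_v (q0 : 'I_Q) :
  lambda_min (A_v x v o T) @[T --> \oo] --> L / enorm v ^+ 2.
Proof.
have [k k0 hk] := trace_A_v_ge q0; have [K hK] := bf_cross_le.
pose N := enorm v ^+ 2; pose l T := lambda_min (A_v x v o T).
pose c T := qf (A_v x v o T) (- v 1 0) (v 0 0).
have cl0 T : 0 <= c T - l T * N.
  have := lambda_min_le_qf (- v 1 0) (v 0 0) (A_v_sym T).
  by rewrite sqrrN addrC -enorm2E subr_ge0.
have L0 : 0 <= L by apply: sumr_ge0 => q _;
  rewrite mulr_ge0 ?sqr_ge0// ltW// s2_inf_gt0.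
have kN0 : 0 < k * N by rewrite mulr_gt0.
(* By the frame equation the gap is the squared mixed entry divided by the longitudinal excess,
   which grows linearly. *)
have gap : \forall T \near \oo,
    0 <= c T - l T * N <= (2 * K ^+ 2 / (k * N)) *
      (harmonic_sum R T ^+ 2 / T%:R).
  near=> T; rewrite cl0/=.
  have T0 : 0 < T%:R :> R by rewrite ltr0n; near: T; exact: nbhs_infty_gt.
  (* The transverse entry and [l T * N] are each at most L; the factor 4 leaves half of the linear
     growth after both are subtracted. *)
  have TL : 4 * L <= k * N * T%:R.
    rewrite [leRHS]mulrC -ler_pdivrMr//; near: T; exact: nbhs_infty_ger.
  have fr := lambda_min_frame (v 0 0) (v 1 0) (A_v_sym T).
  have tr := qf_frame_trace (A_v x v o T).
  have := hk T; rewrite -(ler_pM2r v2_gt0) -tr => hkT.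
  have := qf_perp_le T; have := lambda_min_A_v_le T.
  rewrite -enorm2E in fr; rewrite -/(c T) -/(l T) -/N in fr hkT *.
  move=> lL cL.
  have big : k * N * T%:R / 2 <= qf (A_v x v o T) (v 0 0) (v 1 0) - l T * N
    by lra.
  have b2 : bf (A_v x v o T) (v 0 0) (v 1 0) (- v 1 0) (v 0 0) ^+ 2 <=
     K ^+ 2 * harmonic_sum R T ^+ 2.
    rewrite -exprMn -[leLHS]real_normK ?num_real// lerXn2r// nnegrE//.
    exact: le_trans (hK T).
  have : k * N * T%:R / 2 * (c T - l T * N) <= K ^+ 2 * harmonic_sum R T ^+ 2.
    by apply: le_trans b2; rewrite -fr ler_wpM2r.
  have kNT0 : 0 < k * N * T%:R / 2 by apply: divr_gt0 => //; exact: mulr_gt0.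
  rewrite -ler_pdivlMl// => /le_trans; apply.
  rewrite le_eqVlt; apply/orP; left; apply/eqP.
  by field; rewrite !gt_eqF.
have c0 : c T - l T * N @[T --> \oo] --> (0 : R).
  apply: (squeeze_cvgr gap); first exact: cvg_cst.
  rewrite -(mulr0 (2 * K ^+ 2 / (k * N))); apply: cvgM; first exact: cvg_cst.
  exact: cvg_harmonic_sum_sqr.
have -> : (fun T => lambda_min (A_v x v o T)) =
    (fun T => (c T - (c T - l T * N)) / N).
  by apply/funext => T; rewrite subKr mulfK// gt_eqF.
rewrite -[in X in _ --> X](subr0 L).
apply: cvgM; last exact: cvg_cst.
by apply: cvgB => //; exact: cvg_qf_perp.
Unshelve. all: by end_near. Qed.

(** The trace grows linearly while the smallest eigenvalue stays bounded, so the larger eigenvalue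
    tends to infinity. *)
Lemma cvg_inv_lambda_max_A_v (q0 : 'I_Q) :
  (\tr (A_v x v o T) - lambda_min (A_v x v o T))^-1 @[T --> \oo] --> (0 : R).
Proof.
have [k k0 hk] := trace_A_v_ge q0.
have gap : \forall T \near \oo,
    0 <= (\tr (A_v x v o T) - lambda_min (A_v x v o T))^-1 <= 2 / k / T%:R.
  near=> T.
  have T0 : 0 < T%:R :> R by rewrite ltr0n; near: T; exact: nbhs_infty_gt.
  have TL : 2 * (L / enorm v ^+ 2) <= k * T%:R.
    rewrite [leRHS]mulrC -ler_pdivrMr//; near: T; exact: nbhs_infty_ger.
  have := lambda_min_A_v_le T; rewrite -ler_pdivlMr// => lL.
  have big : k * T%:R / 2 <= \tr (A_v x v o T) - lambda_min (A_v x v o T).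
    by have := hk T; lra.
  have kT0 : 0 < k * T%:R / 2 by rewrite divr_gt0 ?mulr_gt0.
  have b0 := lt_le_trans kT0 big.
  rewrite invr_ge0 (ltW b0)/= -[leRHS](_ : (k * T%:R / 2)^-1 = _) ?lef_pV2//.
  by field; rewrite !gt_eqF.
apply: (squeeze_cvgr gap); first exact: cvg_cst.
rewrite -(mulr0 (2 / k)); apply: cvgM; first exact: cvg_cst.
rewrite -(cvg_shiftS (fun T => T%:R^-1 : R)); exact: cvg_harmonic.
Unshelve. all: by end_near. Qed.

End trajectory.

(** * Fisher information *)

Section fisher.
Context (R : realType) (Q : nat) (x v : 'cV[R]_2) (o : 'I_Q -> 'cV[R]_2).
Variables (alpha sigma : 'I_Q -> R).
Hypothesis v_neq0 : v != 0.
Hypothesis sigma_gt0 : forall q, 0 < sigma q.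
Hypothesis dist_gt0 : forall q t, (1 <= t)%N -> 0 < dist x v o t q.
Variable q0 : 'I_Q.
Hypothesis q0_free : free [:: offset x o q0; v].

Let F := fisher_v x v o alpha sigma.
Let A := A_v x v o.
Let snr := alpha_max2 alpha / sigma_min2 sigma.
Let weight t q : R :=
  alpha q ^+ 2 * t%:R ^+ 2 / (sigma q ^+ 2 * dist x v o t q ^+ 4).

Lemma fisher_gram T : F T = gram weight (relpos x v o) T.
Proof. by []. Qed.

Lemma fisher_sym T : F T 1 0 = F T 0 1.
Proof. by rewrite fisher_gram gram_sym. Qed.

Lemma fisher_weight_ge0 t q : (1 <= t)%N -> 0 <= weight t q.
Proof.
move=> t1; have d0 := dist_gt0 q t1; rewrite /weight.
by apply: divr_ge0; apply: mulr_ge0; rewrite ?sqr_ge0// exprn_ge0// ltW.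
Qed.

(** The positions at times 1 and 2 differ by v, so a vector orthogonal to both is orthogonal to v
    and to the offset, which are independent. *)
Lemma relpos_span y z : dot2 (relpos x v o 1 q0) y z = 0 ->
  dot2 (relpos x v o 2 q0) y z = 0 -> y = 0 /\ z = 0.
Proof.
rewrite !dot2_relpos mul1r => p1 p2.
have pv : dot2 v y z = 0 by lra.
have pl : dot2 (offset x o q0) y z = 0 by lra.
have c0 := free_cross v_neq0 q0_free.
move: c0 pv pl; rewrite /dot2; move: (offset x o q0) => l c0 pv pl.
(* Cramer's rule: the cross product times each coordinate combines the two vanishing dot
   products. *)
split; apply/(mulfI c0); rewrite mulr0.
  rewrite -[LHS](_ : v 0 0 * (l 0 0 * y + l 1 0 * z) * 0 +
    (l 1 0 * (v 0 0 * y + v 1 0 * z) - v 1 0 * (l 0 0 * y + l 1 0 * z)) = _).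
    by rewrite pv pl !mulr0 subr0 addr0.
  by ring.
rewrite -[LHS](_ : v 0 0 * (l 0 0 * y + l 1 0 * z) -
  l 0 0 * (v 0 0 * y + v 1 0 * z) = _).
  by rewrite pv pl !mulr0 subr0.
by ring.
Qed.

Lemma fisher_lambda_min_gt0 T : alpha q0 != 0 -> (2 <= T)%N ->
  0 < lambda_min (F T).
Proof.
move=> a0 T2; apply: (gram_lambda_min_gt0 (q0 := q0)) => //.
- exact: fisher_weight_ge0.
- move=> t t1; have a20 : 0 < alpha q0 ^+ 2 by rewrite exprn_even_gt0.
  by rewrite divr_gt0 ?(mulr_gt0 a20) ?mulr_gt0 ?exprn_gt0 ?dist_gt0 ?ltr0n.
exact: relpos_span.
Qed.

Lemma Delta_v_inv T :
  Delta_v x v o alpha sigma T = (snr * lambda_min (A T))^-1.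
Proof. by rewrite /Delta_v /snr invfM invf_div. Qed.

Lemma snr_ge0 : 0 <= snr.
Proof.
rewrite divr_ge0 ?(ltW (sigma_min2_gt0 q0 sigma_gt0))//.
by apply: le_trans (alpha_max2_ge alpha q0); exact: sqr_ge0.
Qed.

(** Each weight of F is at most [snr] times that of A, and the quadratic forms compare
    accordingly. *)
Lemma lambda_min_fisher_le T : lambda_min (F T) <= snr * lambda_min (A T).
Proof.
rewrite -lambda_minZ ?snr_ge0 ?A_v_sym//; apply: le_lambda_min.
  by rewrite !mxE A_v_sym.
move=> y z; apply: le_trans (lambda_min_le_qf y z (fisher_sym T)) _.
rewrite -[leRHS](_ : snr * qf (A T) y z = _); last by rewrite /qf !mxE; ring.
apply: qf_gram_le => t q t1; have d0 := dist_gt0 q t1.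
rewrite -[leLHS](_ : alpha q ^+ 2 / sigma q ^+ 2 *
  (t%:R ^+ 2 / dist x v o t q ^+ 4) = _).
  rewrite ler_wpM2r ?divr_ge0 ?exprn_ge0 ?(ltW d0)//.
  rewrite ler_pM ?sqr_ge0 ?invr_ge0 ?sqr_ge0// ?alpha_max2_ge//.
  by rewrite lef_pV2 ?posrE ?exprn_gt0// ?sigma_min2_le// (sigma_min2_gt0 q0).
by field; rewrite !gt_eqF.
Qed.

(** Invertibility makes the nonnegative smallest eigenvalue of F positive; the trace of the inverse
    then exceeds its reciprocal by that of the other eigenvalue. *)
Lemma Delta_v_le_crlb T : F T \in unitmx ->
  Delta_v x v o alpha sigma T <= crlb_v x v o alpha sigma T.
Proof.
move=> uF; have sF := fisher_sym T.
have l0 : 0 < lambda_min (F T).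
  rewrite lt_def unitmx_lambda_min_neq0//.
  exact/gram_lambda_min_ge0/fisher_weight_ge0.
rewrite Delta_v_inv /crlb_v trace_invmx2//.
have [_ la lc] := lambda_min_char sF.
have m0 : 0 <= (\tr (F T) - lambda_min (F T))^-1.
  by rewrite invr_ge0 trace2E; lra.
apply: (@le_trans _ _ (lambda_min (F T))^-1); last by rewrite lerDl.
have := lambda_min_fisher_le T => le.
by rewrite lef_pV2 ?posrE// (lt_le_trans l0).
Qed.

(** * Stations with equal squared gains and equal noise variances *)

Section equality_case.
Hypothesis ms : forall q,
  sigma_min2 sigma = sigma q ^+ 2 /\ alpha_max2 alpha = alpha q ^+ 2.

Lemma fisher_uniform T : F T = snr *: A T.
Proof.
rewrite /F /fisher_v /A /A_v !big_nat scaler_sumr;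
  apply: eq_bigr => t /andP[t1 _].
rewrite scaler_sumr; apply: eq_bigr => q _; rewrite scalerA; congr (_ *: _).
have [es ea] := ms q; rewrite /snr es ea; have := dist_gt0 q t1 => d0.
by field; rewrite !gt_eqF.
Qed.

Lemma Delta_v_uniform T :
  Delta_v x v o alpha sigma T = (lambda_min (F T))^-1.
Proof. by rewrite Delta_v_inv fisher_uniform lambda_minZ ?A_v_sym ?snr_ge0. Qed.

(** Once F is invertible, the difference is the reciprocal of its larger eigenvalue, that is of
    [snr] times the larger eigenvalue of A. *)
Lemma cvg_crlb_sub_Delta :
  crlb_v x v o alpha sigma T - Delta_v x v o alpha sigma T
    @[T --> \oo] --> (0 : R).
Proof.
(* If [alpha q0] is 0, then [snr] and F vanish; [invmx] fixes the zero matrix and the inverse of 0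
   is 0, so both terms are 0. *)
have [a0|a0] := eqVneq (alpha q0) 0.
  have s0 : snr = 0 by have [_ ea] := ms q0; rewrite /snr ea a0 expr0n mul0r.
  rewrite [X in X @ _](_ : _ = cst 0); first exact: cvg_cst.
  apply/funext => T; rewrite Delta_v_inv s0 mul0r invr0 subr0 /crlb_v.
  rewrite -/(F T) fisher_uniform s0 scale0r /invmx ifF ?mxtrace0//.
  by rewrite unitmxE det0 unitr0.
apply: cvg_trans (_ : snr^-1 * (\tr (A T) - lambda_min (A T))^-1
  @[T --> \oo] --> _).
  apply: near_eq_cvg; near=> T.
  have T2 : (2 <= T)%N by near: T; exact: nbhs_infty_ge.
  have l0 := fisher_lambda_min_gt0 a0 T2.
  rewrite Delta_v_uniform /crlb_v trace_invmx2 ?fisher_sym// addrAC subrr add0r.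
  rewrite -/(F T) fisher_uniform lambda_minZ ?A_v_sym ?snr_ge0//.
  by rewrite mxtraceZ -mulrBr [RHS]invfM.
rewrite -(mulr0 snr^-1); apply: cvgM; first exact: cvg_cst.
exact: cvg_inv_lambda_max_A_v.
Unshelve. all: by end_near. Qed.

End equality_case.

Lemma C_v_inv : C_v x v o alpha sigma = (snr *
  ((\sum_(q < Q) s2_inf x v o q * dot2 (offset x o q) (- v 1 0) (v 0 0) ^+ 2)
     / enorm v ^+ 2))^-1.
Proof.
rewrite /C_v; congr (_ * _)^-1; rewrite mulr_suml; apply: eq_bigr => q _.
by rewrite enorm_proj_perp// mulrA.
Qed.

Lemma cvg_Delta_v :
  Delta_v x v o alpha sigma T @[T --> \oo] --> C_v x v o alpha sigma.
Proof.
(* When [snr] is 0, the sequence and its limit are both the default inverse of 0. *)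
rewrite C_v_inv (funext Delta_v_inv); have [->|s0] := eqVneq snr 0.
  rewrite mul0r (_ : (fun T => _) = cst 0^-1); first exact: cvg_cst.
  by apply/funext => T; rewrite mul0r.
apply: cvgV; last first.
  by apply: cvgM; [exact: cvg_cst|exact: cvg_lambda_min_A_v].
rewrite mulf_neq0// mulf_neq0 ?invr_eq0 ?sqrf_eq0 ?gt_eqF ?enorm_gt0//.
(* The limit is nonzero: independence of the offset and v makes the term of q0 positive. *)
rewrite (bigD1 q0)//= ltr_pwDl//.
  rewrite mulr_gt0 ?s2_inf_gt0// exprn_even_gt0//=.
  exact: free_cross.
by apply: sumr_ge0 => q _; rewrite mulr_ge0 ?sqr_ge0// ltW// s2_inf_gt0.
Qed.

End fisher.

Theorem theorem2 (R : realType) (Q : nat) (x v : 'cV[R]_2)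
    (o : 'I_Q -> 'cV[R]_2) (alpha sigma : 'I_Q -> R)
    (v_neq0 : v != 0)
    (sigma_gt0 : forall q, 0 < sigma q)
    (dist_gt0 : forall q t, (1 <= t)%N -> 0 < dist x v o t q)
    (lv_free : exists q, free [:: offset x o q; v]) :
  (* F_T is invertible for T >= 2 whenever every station is informative *)
  ((forall q, alpha q != 0) ->
     forall T, (2 <= T)%N -> fisher_v x v o alpha sigma T \in unitmx) /\
  (* B(v) >= Delta_T *)
  (forall T, fisher_v x v o alpha sigma T \in unitmx ->
     Delta_v x v o alpha sigma T <= crlb_v x v o alpha sigma T) /\
  (* the equality case: Delta_T is exactly the largest eigenvalue of F_T^-1,
     and B(v) - Delta_T vanishes asymptotically *)
  ((forall q, sigma_min2 sigma = sigma q ^+ 2 /\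
              alpha_max2 alpha = alpha q ^+ 2) ->
     (forall T, Delta_v x v o alpha sigma T =
                (lambda_min (fisher_v x v o alpha sigma T))^-1) /\
     crlb_v x v o alpha sigma T - Delta_v x v o alpha sigma T
       @[T --> \oo] --> (0 : R)) /\
  (* the limit of Delta_T, with s2_inf q the limit of a convergent series *)
  (forall q, cvgn (s2 x v o q)) /\
  Delta_v x v o alpha sigma T @[T --> \oo] --> C_v x v o alpha sigma /\
  (* the upper bound on s2_inf q *)
  (exists2 rho : R, 0 < rho &
     forall q t, (1 <= t)%N -> rho * t%:R < dist x v o t q) /\
  (forall q (rho : R), 0 < rho ->
     (forall t, (1 <= t)%N -> rho * t%:R < dist x v o t q) ->
     s2_inf x v o q <= (rho ^+ 4)^-1 * limn (@invsq_sum R) /\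
     (rho ^+ 4)^-1 * limn (@invsq_sum R) = pi ^+ 2 / (6 * rho ^+ 4)) /\
  cvgn (@invsq_sum R).
Proof.
have [q0 q0_free] := lv_free.
split.
  move=> a0 T T2; apply: lambda_min_unitmx; first exact: fisher_sym.
  exact: (fisher_lambda_min_gt0 v_neq0 sigma_gt0 dist_gt0 q0_free).
split; first by move=> T; exact: (Delta_v_le_crlb sigma_gt0 dist_gt0 q0).
split.
  move=> ms; split.
    by move=> T; exact: (Delta_v_uniform sigma_gt0 dist_gt0 q0 ms).
  exact: (cvg_crlb_sub_Delta v_neq0 sigma_gt0 dist_gt0 q0_free ms).
split; first by move=> q; exact: is_cvg_s2.
split; first exact: cvg_Delta_v q0_free.
split; first exact: dist_lower.
split; last exact: is_cvg_invsq_sum.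
move=> q rho rho0 rd; split; first exact: s2_inf_le.
by rewrite basel; field; rewrite gt_eqF.
Qed.
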